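(* (i) For every fixed real number $\rho>2$, asymptotically almost surely $$\min\overline{R}(G(\rho,n)) \;\geq\; \frac{n^{3/2-1/\rho}}{4\log n\,\log\log n}.$$ In particular, almost every $3$-regular $n$-vertex graph $G$ (that is, $G=G(3,n)$ asymptotically almost surely) satisfies $$\min\overline{R}(G)\;\geq\; \frac{n^{7/6}}{4\log n\,\log\log n}.$$ (ii) Asymptotically almost surely, $$\min\overline{R}\left(G\left(2+\frac{9\log\log n}{\log n},\,n\right)\right)\;\geq\;\frac{n\log n}{2\log\log n}.$$
   Context: All logarithms are base 2. An ordered graph is a pair $\mathcal{G}=(G,\prec)$ where $G$ is a (simple) graph and $\prec$ is a total ordering of its vertices; $\mathcal{G}$ is called an ordering of $G$. Two ordered graphs are isomorphic if there is a graph isomorphism between them preserving the vertex orderings. $\mathcal{K}_N$ denotes the (unique up to isomorphism) ordered complete graph on $N$ vertices. $\mathcal{G}=(G,\prec_1)$ is an ordered subgraph of $\mathcal{H}=(H,\prec_2)$ if $G$ is a subgraph of $H$ and $\prec_1$ is a suborder of $\prec_2$. The ordered Ramsey number $\overline{R}(\mathcal{G})$ is the minimum integer $N$ such that every $2$-coloring of the edges of $\mathcal{K}_N$ contains a monochromatic ordered subgraph isomorphic to $\mathcal{G}$. For a graph $G$, $\min\overline{R}(G):=\min\{\overline{R}(\mathcal{G}) : \mathcal{G}\text{ is an ordering of }G\}$. For a real number $\rho>0$ and a positive integer $n$ with $\lceil\rho n\rceil$ even, a graph $G$ on $n$ vertices is $\rho$-regular if every vertex has degree $\lfloor\rho\rfloor$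 or $\lceil\rho\rceil$ and the total number of edges of $G$ is $\lceil\rho n\rceil/2$. $G(\rho,n)$ denotes the random $\rho$-regular graph drawn uniformly from the set of all $\rho$-regular graphs on the vertex set $[n]=\{1,\dots,n\}$; here $\rho$ may depend on $n$, and only those $n$ for which $\lceil\rho n\rceil$ is even (so that $G(\rho,n)$ is defined) are considered. An event holds for $G(\rho,n)$ asymptotically almost surely if its probability tends to $1$ as $n\to\infty$. *)

(* Defs.v *)
From HB Require Import structures.
From mathcomp Require Import all_boot all_order all_algebra.
From mathcomp Require Import all_classical all_reals all_analysis.
Import Order.TTheory GRing.Theory Num.Theory numFieldNormedType.Exports.

Set Implicit Arguments.
Unset Strict Implicit.
Unset Printing Implicit Defensive.

Local Open Scope ring_scope.

Record sgraph (V : finType) := SGraph {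
  edges :> {set {set V}};
  edges_card2 : [forall e in edges, #|e| == 2%N] }.

HB.instance Definition _ (V : finType) := [isSub for @edges V].
HB.instance Definition _ (V : finType) := [Finite of sgraph V by <:].

Definition degree (V : finType) (G : sgraph V) (v : V) : nat :=
  #|[set e in edges G | v \in e]|.

Record ordered_graph (V : finType) := OrderedGraph {
  og_graph :> sgraph V;
  og_le : rel V;
  og_anti : antisymmetric og_le;
  og_trans : transitive og_le;
  og_total : total og_le }.

(* [f] is an isomorphism from [G] onto an ordered subgraph of [H]. *)
Definition ordered_copy (V W : finType) (G : ordered_graph V)
    (H : ordered_graph W) (f : V -> W) : Prop :=
  [/\ injective f,
      forall e : {set V}, e \in edges G -> f @: e \in edges H
    & {mono f : x y / og_le G x y >-> og_le H x y}].

Fact complete_card2 (V : finType) :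
  [forall e in [set e : {set V} | #|e| == 2%N], #|e| == 2%N].
Proof. by apply/forall_inP => e; rewrite inE. Qed.

Definition complete_graph (V : finType) : sgraph V :=
  SGraph (complete_card2 V).

Definition ordered_complete (N : nat) : ordered_graph 'I_N :=
  @OrderedGraph _ (complete_graph 'I_N) (fun i j : 'I_N => (i <= j)%N)
    (fun i j h => val_inj (anti_leq h))
    (fun j i k => @leq_trans j i k)
    (fun i j => leq_total i j).

(* Only the values of the coloring [c] on two-element sets, that is on the
   edges of the complete graph, matter. *)
Definition ramsey_arrow (V : finType) (G : ordered_graph V) (N : nat) : Prop :=
  forall c : {set 'I_N} -> bool,
  exists f : V -> 'I_N, ordered_copy G (ordered_complete N) f /\
    exists b : bool, forall e : {set V}, e \in edges G -> c (f @: e) = b.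

Lemma ramsey_seq (m k : nat) : exists N : nat,
  forall (T : eqType) (c : rel T) (s : seq T), (N <= size s)%N ->
  (exists t, [/\ subseq t s, size t = m & pairwise c t]) \/
  (exists t, [/\ subseq t s, size t = k & pairwise (fun x y => ~~ c x y) t]).
Proof.
elim: m k => [|m IHm] k.
  by exists 0%N => T c s _; left; exists [::]; rewrite sub0seq.
elim: k => [|k [Nk Hk]].
  by exists 0%N => T c s _; right; exists [::]; rewrite sub0seq.
have [Nm Hm] := IHm k.+1.
exists (Nm + Nk).+1 => T c [//|x s] /=; rewrite ltnS => Hs.
have sz : (size (seq.filter (c x) s) + size (seq.filter (predC (c x)) s) = size s)%N.
  by rewrite !size_filter count_predC.
have ext a t : subseq t (seq.filter a s) -> subseq (x :: t) (x :: s).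
  by move=> h; rewrite /= eqxx (subseq_trans h) // filter_subseq.
have wid a t : subseq t (seq.filter a s) -> subseq t (x :: s).
  move=> h; apply: (subseq_trans h).
  by apply: (subseq_trans (filter_subseq _ _)); exact: subseq_cons.
have allt a t : subseq t (seq.filter a s) -> all a t.
  move=> h; apply/allP => y /(mem_subseq h).
  by rewrite mem_filter => /andP[].
case: (leqP Nm (size (seq.filter (c x) s))) => hm.
  case: (Hm T c _ hm) => -[t [st szt pt]].
    left; exists (x :: t); split; [exact: ext st|by rewrite /= szt|].
    by rewrite /= pt andbT; exact: allt st.
  by right; exists t; split => //; exact: wid st.
have hk : (Nk <= size (seq.filter (predC (c x)) s))%N.
  rewrite -(leq_add2l Nm) (leq_trans Hs) // -sz leq_add2r; exact: ltnW.
case: (Hk T c _ hk) => -[t [st szt pt]].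
  by left; exists t; split => //; exact: wid st.
right; exists (x :: t); split; [exact: ext st|by rewrite /= szt|].
by rewrite /= pt andbT; exact: allt st.
Qed.

Lemma ramsey_arrow_exists (V : finType) (G : ordered_graph V) :
  exists N, `[< ramsey_arrow G N >].
Proof.
have [N HN] := ramsey_seq #|V| #|V|; exists N; apply/asboolP => c.
pose r := sort (og_le G) (enum V).
have rV v : v \in r by rewrite mem_sort mem_enum.
have szr : size r = #|V| by rewrite size_sort -cardE.
have lts u v : og_le G u v = (index u r <= index v r)%N.
  have srt : sorted (og_le G) r by apply: sort_sorted; exact: og_total.
  have refl x : og_le G x x by have := @og_total _ G x x; rewrite orbb.
  have le x y : (index x r <= index y r)%N -> og_le G x y.
    move=> h; rewrite -[x](nth_index x (rV x)) -[y](nth_index x (rV y)).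
    by apply: (sorted_leq_nth (@og_trans _ G) refl _ srt) => //;
      rewrite inE index_mem.
  apply/idP/idP; last exact: le.
  move=> uv; case: (leqP (index u r) (index v r)) => // vu.
  have e : u = v by apply: (@og_anti _ G); rewrite uv le // ltnW.
  by move: vu; rewrite e ltnn.
have key (t : seq 'I_N) (b : bool) : subseq t (enum 'I_N) -> size t = #|V| ->
    pairwise (fun x y => c [set x; y] == b) t ->
    exists f : V -> 'I_N, ordered_copy G (ordered_complete N) f /\
    exists b : bool, forall e : {set V}, e \in edges G -> c (f @: e) = b.
  move=> st szt pt.
  have ltt v : (index v r < size t)%N by rewrite szt -szr index_mem.
  pose f v := tnth (in_tuple t) (Ordinal (ltt v)).
  have fE x0 v : f v = nth x0 t (index v r).
    by rewrite /f (tnth_nth x0).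
  have stt : sorted (relpre val ltn) t.
    apply: (subseq_sorted _ st) => [y x z|]; first exact: ltn_trans.
    by rewrite -sorted_map val_enum_ord iota_ltn_sorted.
  have flt u v : (index u r < index v r)%N -> (f u < f v)%N.
    have x0 := f u; move=> h; rewrite !(fE x0).
    have tr : transitive (relpre (@nat_of_ord N) ltn).
      by move=> y x z; exact: ltn_trans.
    by apply: (sorted_ltn_nth tr x0 stt) => //; rewrite inE ltt.
  have fmono u v : (f u <= f v)%N = og_le G u v.
    rewrite lts; case: (ltngtP (index u r) (index v r)) => [/flt/ltnW->//|h|h].
      by rewrite leqNgt (flt _ _ h).
    by have x0 := f u; rewrite !(fE x0) h leqnn.
  have finj : injective f.
    move=> u v e; apply: (@og_anti _ G); by rewrite -!fmono e leqnn.
  exists f; split; first split => //.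
    move=> e eG; rewrite inE card_imset //.
    exact: (forall_inP (edges_card2 G)).
  exists b => e eG.
  have /cards2P[u [v [uv ->]]] := forall_inP (edges_card2 G) e eG.
  have main x y : (index x r < index y r)%N -> c [set f x; f y] = b.
    have x0 := f x; move=> h; apply/eqP; rewrite !(fE x0).
    by apply: (pairwiseP x0 pt) => //; rewrite inE ltt.
  rewrite imsetU1 imset_set1.
  case: (ltngtP (index u r) (index v r)) => [/main//|/main|h].
    by rewrite finset.setUC.
  by case/eqP: uv; rewrite -(nth_index u (rV u)) h nth_index.
have [] := HN _ (fun x y : 'I_N => c [set x; y]) (enum 'I_N).
- by rewrite size_enum_ord.
- case=> t [st szt pt]; apply: (key t true st szt).
  by apply: sub_pairwise pt => x y /= ->.
- case=> t [st szt pt]; apply: (key t false st szt).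
  by apply: sub_pairwise pt => x y /= /negbTE ->.
Qed.

Definition ordered_ramsey (V : finType) (G : ordered_graph V) : nat :=
  ex_minn (ramsey_arrow_exists G).

Lemma ordering_exists (V : finType) (G : sgraph V) : exists N,
  `[< exists2 OG : ordered_graph V, og_graph OG = G & ordered_ramsey OG = N >].
Proof.
pose le (u v : V) := (enum_rank u <= enum_rank v)%N.
have anti : antisymmetric le.
  by move=> u v h; apply: enum_rank_inj; apply: val_inj; exact: anti_leq h.
have tr : transitive le by move=> v u w; exact: leq_trans.
have tot : total le by move=> u v; exact: leq_total.
exists (ordered_ramsey (OrderedGraph G anti tr tot)); apply/asboolP.
by exists (OrderedGraph G anti tr tot).
Qed.

Definition min_ordered_ramsey (V : finType) (G : sgraph V) : nat :=
  ex_minn (ordering_exists G).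

Definition rho_regular (R : realType) (rho : R) (n : nat) (G : sgraph 'I_n) : bool :=
  [forall v, (Posz (degree G v) == Num.floor rho)
          || (Posz (degree G v) == Num.ceil rho)]
  && (Posz (#|edges G|.*2) == Num.ceil (rho * n%:R)).

Definition regular_graphs (R : realType) (rho : R) (n : nat) : {set sgraph 'I_n} :=
  [set G | rho_regular rho G].

(* Probability that G(rho, n) satisfies [P]; it is 0 if no rho-regular graph
   on n vertices exists. *)
Definition random_regular_prob (R : realType) (rho : R) (n : nat) (P : pred (sgraph 'I_n)) : R :=
  #|[set G in regular_graphs rho n | P G]|%:R / #|regular_graphs rho n|%:R.

(* The limit is taken along those n for which the ceiling of rho n is even. *)
Definition random_regular_aas (R : realType) (rho : nat -> R)
    (P : forall n, pred (sgraph 'I_n)) : Prop :=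
  (random_regular_prob (rho n) (P n) @[n --> within
     [set n | (2 %| Num.ceil (rho n * n%:R))%Z] \oo] --> (1 : R))%classic.

Definition log2 (R : realType) (x : R) : R := ln x / ln 2.

(* Main.v *)
(** Colour the pairs of $[N]$ by cutting $[N]$ into $M$ intervals of length $L$
and colouring the sets $\{i,j\}$ of interval indices at random.  An ordered copy
of $G$ pulls the intervals back to a monotone map $p$ from $V(G)$ to $[M]$ with
fibres of size at most $L$, and is monochromatic with probability
$2^{1-k}$, where $k$ counts the pairs of fibres joined by an edge.  Only
$\binom{n+M-1}{n} < 2^m$ maps are monotone, so if some ordering of $G$ has
ordered Ramsey number at most $ML$, then some $p$ has $k \le m$.  There are at
most $M^{n+2m} (mL^2)^E/E!$ such graphs with $E$ edges.

On the other side there are at least $E!/C^E$ regular graphs up to a factor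
polynomial in $n$: build them edge by edge, where a partial realization with
$k$ missing edges has of order $k^2$ addable pairs; when only boundedly many
edges are missing, finish by switchings that remove an edge $xy$ and add $ux$
and $vy$.  With $M \approx n/(\ln n)^{3/2}$ and $m \approx n/\ln n$ the quotient
is at most $e^{-n}$. *)
Require Import Defs.
From mathcomp Require Import all_boot all_order all_algebra.
From mathcomp Require Import all_classical all_reals all_analysis.
From mathcomp Require Import zify ring lra.
Import Order.TTheory GRing.Theory Num.Theory numFieldNormedType.Exports.

Set Implicit Arguments.
Unset Strict Implicit.
Unset Printing Implicit Defensive.

Local Open Scope nat_scope.

(** * Double counting *)

(** Counts the related pairs from both sides; the factor [c] allows a lower degree bound [a / c]
    without division. *)
Lemma leq_double_count (T1 T2 : finType) (X : {set T1}) (Y : {set T2})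
    (r : T1 -> T2 -> bool) (a b c : nat) :
  (forall x, x \in X -> a <= c * #|[set y in Y | r x y]|) ->
  (forall y, y \in Y -> #|[set x in X | r x y]| <= b) ->
  a * #|X| <= c * b * #|Y|.
Proof.
move=> hX hY.
have h1 : a * #|X| <= \sum_(x in X) c * #|[set y in Y | r x y]|.
  by rewrite mulnC -sum_nat_const; exact: leq_sum.
apply: leq_trans h1 _; rewrite -big_distrr /= -mulnA leq_mul2l.
apply/orP; right.
under eq_bigr do rewrite -sum1dep_card big_mkcondr /=.
rewrite exchange_big /= mulnC -sum_nat_const; apply: leq_sum => y /hY.
by rewrite -sum1dep_card big_mkcondr.
Qed.

(** A union bound: the fibres of [r] over [Y] cover [X]. It also serves to bound the size of an
    image or of an encoding. *)
Lemma leq_card_cover_by (T1 T2 : finType) (X : {set T1}) (Y : {set T2})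
    (r : T1 -> T2 -> bool) (b : nat) :
  (forall x, x \in X -> exists2 y, y \in Y & r x y) ->
  (forall y, y \in Y -> #|[set x in X | r x y]| <= b) ->
  #|X| <= b * #|Y|.
Proof.
move=> hX hY; rewrite -[#|X|]mul1n -[b]mul1n; apply: leq_double_count hY.
move=> x /hX [y yY rxy]; rewrite mul1n card_gt0; apply/finset.set0Pn.
by exists y; rewrite inE yY.
Qed.

(** * Block colourings *)

Section Partition.
Variables (V : finType) (M L m : nat).
Implicit Types (S : {set {set V}}) (p : {ffun V -> 'I_M.+1}).

Definition small_classes p := [forall i, #|[set v | p v == i]| <= L].

Definition traces p S := [set p @: (e : {set V}) | e in S].

(** The map [p] is not tied to any vertex order, so counting these edge sets involves no union over
    the orderings of a graph. *)
Definition block_compressible S :=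
  [exists p, small_classes p && (#|traces p S| <= m)].

Lemma card_constant_on (T : finType) (P : {set T}) (b : bool) :
  #|[set f : {ffun T -> bool} | [forall x in P, f x == b]]| * 2 ^ #|P|
    = 2 ^ #|T|.
Proof.
pose F x : pred bool := if x \in P then pred1 b else predT.
have -> : #|[set f : {ffun T -> bool} | [forall x in P, f x == b]]|
    = #|(family F : simpl_pred {ffun T -> bool})|.
  apply: eq_card => f; rewrite inE; apply/forallP/familyP => h x.
    by have := h x; rewrite /F; case: ifP.
  by have := h x; rewrite /F; case: ifP.
rewrite card_family foldrE big_map big_enum /=.
have -> : \prod_x #|F x| = \prod_(x in ~: P) 2.
  rewrite [RHS]big_mkcond /=; apply: eq_bigr => x _; rewrite inE /F.
  by case: ifP => _ /=; rewrite ?card1 ?card_bool.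
by rewrite prod_nat_const -expnD addnC cardsC.
Qed.

(** The random colouring, done by counting. Every colouring [chi] of the sets of block indices is
    constant on the traces of some monotone map with small fibres. If no such map has at most [m]
    traces, one map and one colour account for at most a fraction [2 ^ -(m + 1)] of all [chi], and
    there are too few maps. *)
Lemma arrow_compressible (G : ordered_graph V) N : 0 < L ->
  N <= M.+1 * L -> 'C(#|V| + M, #|V|) < 2 ^ m ->
  ramsey_arrow G N -> block_compressible (edges G).
Proof.
move=> L0 NML Cm arr; apply/existsP; apply: contraPP Cm => nex.
have big p : small_classes p -> m < #|traces p (edges G)|.
  by move=> sp; rewrite ltnNge; apply/negP => h; apply: nex; exists p; rewrite sp.
apply/negP; rewrite -leqNgt.
pose r := sort (og_le G) (enum V).
have rV v : v \in r by rewrite mem_sort mem_enum.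
have szr : size r == #|V| by rewrite size_sort -cardE.
have srt : sorted (og_le G) r by apply: sort_sorted; exact: og_total.
(* A map is stored as the list of its values along the sorted vertices, so monotone maps become
   sorted tuples. The default is never reached, since [r] lists every vertex. *)
pose pt (t : #|V|.-tuple 'I_M.+1) : {ffun V -> 'I_M.+1} :=
  [ffun v => nth ord0 t (index v r)].
pose Y0 := [set t : #|V|.-tuple 'I_M.+1 | sorted leq (map val t)].
pose Y := [set y : #|V|.-tuple 'I_M.+1 * bool
          | (sorted leq (map val y.1)) && small_classes (pt y.1)].
have cY : #|Y| <= 2 * 'C(#|V| + M, #|V|).
  have <- : #|Y0| = 'C(#|V| + M, #|V|) by exact: card_sorted_tuples.
  rewrite mulnC -card_bool -(cardsT bool) -cardsX.
  apply: subset_leq_card; apply/fintype.subsetP => -[t b]; rewrite !inE /=.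
  by case/andP=> ->.
pose X := [set: {ffun {set 'I_M.+1} -> bool}].
pose R (chi : {ffun {set 'I_M.+1} -> bool}) (y : #|V|.-tuple 'I_M.+1 * bool) :=
  [forall x in traces (pt y.1) (edges G), chi x == y.2].
have : #|X| <= 2 ^ #|{set 'I_M.+1}| %/ 2 ^ m.+1 * #|Y|.
  apply: (@leq_card_cover_by _ _ _ _ R) => [chi _|[t b] ]; last first.
    rewrite inE => /andP[_ /big /=]; set P := traces _ _ => mP.
    rewrite leq_divRL ?expn_gt0 //.
    rewrite -(card_constant_on P b) leq_mul ?leq_pexp2l //.
    by apply: subset_leq_card; apply/fintype.subsetP => chi; rewrite !inE.
  (* The bound [N <= M.+1 * L] keeps the quotient below [M.+1], so [inord] does not truncate. *)
  pose blk (a : 'I_N) : 'I_M.+1 := inord (a %/ L).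
  have blkE a : blk a = a %/ L :> nat.
    by rewrite inordK // ltn_divLR // (leq_trans (ltn_ord a)).
  have [f [[finj fcopy fmono] [b fb]]] := arr (fun e => chi (blk @: e)).
  pose p : {ffun V -> 'I_M.+1} := [ffun v => blk (f v)].
  have szt : size (map p r) == #|V| by rewrite size_map.
  have ptE : pt (Tuple szt) = p.
    apply/ffunP => v; rewrite ffunE (nth_map v) ?index_mem //.
    by rewrite nth_index.
  exists (Tuple szt, b); rewrite ?inE /R /= ?ptE.
    apply/andP; split; last first.
      apply/forallP => i; rewrite -[leqRHS]card_ord -cardsT.
      (* Inside a fibre the quotient of [f v] by [L] is fixed, so the residue determines [v]. *)
      pose g v : 'I_L := Ordinal (ltn_pmod (f v) L0).
      have gi : {in [set v | p v == i] &, injective g}.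
        move=> u v; rewrite !inE !ffunE => /eqP hu /eqP hv [guv].
        apply: finj; apply: val_inj => /=.
        by rewrite (divn_eq (f u) L) (divn_eq (f v) L) guv -!blkE hu hv.
      by rewrite -(card_in_imset gi) subset_leq_card //; exact: finset.subsetT.
    rewrite -map_comp sorted_map; apply: sub_sorted srt => u v uv /=.
    by rewrite !ffunE !blkE leq_div2r //; have := fmono u v; rewrite /= uv.
  apply/forall_inP => x /imsetP [e eG ->]; rewrite -(fb e eG).
  apply/eqP; congr (chi _); rewrite -imset_comp; apply: eq_imset => v /=.
  by rewrite ffunE.
rewrite cardsT card_ffun card_bool; set T := #|{set 'I_M.+1}| => h.
have {}h : 2 ^ T * 2 ^ m.+1 <= 2 ^ T * #|Y|.
  apply: leq_trans (_ : 2 ^ T %/ 2 ^ m.+1 * #|Y| * 2 ^ m.+1 <= _).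
    by rewrite leq_mul2r h orbT.
  by rewrite mulnAC leq_mul2r leq_trunc_div orbT.
(* One factor 2 of [2 ^ m.+1] pays for the two colours recorded in [Y]. *)
move: h; rewrite leq_pmul2l ?expn_gt0 // => h.
by have := leq_trans h cY; rewrite expnS leq_pmul2l.
Qed.

(** A compressible edge set is encoded by [p], by a list [q] of [m] pairs of blocks containing its
    traces, and by a choice of [E] edges among those that [p] sends to a pair of [q]. Each pair of
    blocks carries at most [L ^ 2] edges, and [E!] turns the binomial into a falling factorial. *)
Lemma card_block_compressible (E : nat) : 0 < m ->
  #|[set S : {set {set V}} | [&& [forall e in S, #|e| == 2], #|S| == E
      & block_compressible S]]| * E`! <= M.+1 ^ (#|V| + m.*2) * (m * L ^ 2) ^ E.
Proof.
move=> m0.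
pose U (p : {ffun V -> 'I_M.+1}) (q : {ffun 'I_m -> 'I_M.+1 * 'I_M.+1}) :=
  [set e : {set V} | (#|e| == 2) &&
    [exists k, p @: e == [set (q k).1; (q k).2]]].
have cU p q : small_classes p -> #|U p q| <= m * L ^ 2.
  move=> /forallP sp.
  pose Y := [set y : 'I_m * (V * V) |
     (p y.2.1 == (q y.1).1) && (p y.2.2 == (q y.1).2)].
  have cY : #|Y| <= m * L ^ 2.
    rewrite -sum1dep_card.
    rewrite -(pair_big_dep xpredT
      (fun k (y : V * V) => (p y.1 == (q k).1) && (p y.2 == (q k).2))
      (fun _ _ => 1)) /=.
    rewrite -[X in X * _]card_ord -sum_nat_const; apply: leq_sum => k _.
    rewrite sum1dep_card.
    have -> : [set x : V * V | (p x.1 == (q k).1) && (p x.2 == (q k).2)]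
      = finset.setX [set v | p v == (q k).1] [set v | p v == (q k).2].
      by apply/finset.setP => -[x y]; rewrite !inE.
    by rewrite cardsX -mulnn leq_mul.
  rewrite (leq_trans _ cY) // -[#|Y|]mul1n.
  apply: (@leq_card_cover_by _ _ _ _ (fun e y => e == [set y.2.1; y.2.2])).
    move=> e; rewrite inE => /andP[/cards2P [x [y [xy ->]]] /existsP [k]].
    rewrite imsetU1 imset_set1 => /eqP h.
    have : p x \in [set (q k).1; (q k).2] by rewrite -h !inE eqxx.
    have : p y \in [set (q k).1; (q k).2] by rewrite -h !inE eqxx orbT.
    have : (q k).1 \in [set p x; p y] by rewrite h !inE eqxx.
    have : (q k).2 \in [set p x; p y] by rewrite h !inE eqxx orbT.
    rewrite !inE => q2 q1 py px.
    (* Equality of unordered traces fixes the ends only up to a swap, so [(x, y)] or [(y, x)] is the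
       witness. *)
    case: (boolP ((p x == (q k).1) && (p y == (q k).2))) => hh.
      by exists (k, (x, y)); rewrite ?inE.
    exists (k, (y, x)); rewrite ?inE /= 1?finset.setUC //.
    move: q1 q2 px py hh.
    rewrite [(q k).1 == _]eq_sym [(q k).1 == _]eq_sym.
    rewrite [(q k).2 == _]eq_sym [(q k).2 == _]eq_sym.
    by do !case: eqP.
  move=> y _; rewrite (leq_trans (subset_leq_card _)
    (_ : #|[set [set y.2.1; y.2.2]]| <= 1)) ?cards1 //.
  by apply/fintype.subsetP => e; rewrite !inE => /andP[].
set B := [set S | _].
have hB : #|B| <= 'C(m * L ^ 2, E)
    * #|[set: {ffun V -> 'I_M.+1} * {ffun 'I_m -> 'I_M.+1 * 'I_M.+1}]|.
  pose Y := [set y : {ffun V -> 'I_M.+1} * {ffun 'I_m -> 'I_M.+1 * 'I_M.+1}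
            | small_classes y.1].
  apply: leq_trans (_ : 'C(m * L ^ 2, E) * #|Y| <= _); last first.
    by rewrite leq_mul2l subset_leq_card ?orbT //; exact: finset.subsetT.
  apply: (@leq_card_cover_by _ _ _ _ (fun S y => S \subset U y.1 y.2)).
    move=> S; rewrite inE => /and3P[/forall_inP S2 /eqP SE /existsP [p /andP[sp cp]]].
    pose Q := traces p S.
    (* [q] enumerates the traces of [p], padded with junk up to length [m]. *)
    pose q : {ffun 'I_m -> 'I_M.+1 * 'I_M.+1} :=
      [ffun k : 'I_m => odflt (ord0, ord0)
         [pick ij | nth finset.set0 (enum Q) k == [set ij.1; ij.2]]].
    exists (p, q); first by rewrite inE.
    apply/fintype.subsetP => e eS; rewrite inE S2 //=.
    have /cards2P [x [y [xy exy]]] := S2 e eS.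
    have pQ : p @: e \in enum Q by rewrite mem_enum; apply: imset_f.
    have ik : index (p @: e) (enum Q) < m.
      by rewrite (leq_trans _ cp) // cardE index_mem.
    apply/existsP; exists (Ordinal ik); rewrite ffunE /= nth_index //.
    case: pickP => [[i j] /eqP -> //|/(_ (p x, p y))] /=.
    by rewrite exy imsetU1 imset_set1 eqxx.
  move=> [p q]; rewrite inE /= => sp.
  apply: leq_trans (leq_bin2l E (cU p q sp)).
  rewrite -cards_draws; apply: subset_leq_card.
  apply/fintype.subsetP => S; rewrite !inE.
  by move=> /andP[/and3P[_ -> _] ->].
apply: leq_trans (leq_mul hB (leqnn _)) _.
rewrite cardsT card_prod !card_ffun card_prod !card_ord mulnAC bin_ffact mulnC.
rewrite mulnn -expnM mul2n -expnD leq_mul2l; apply/orP; right.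
move: (m * L ^ 2) => K; elim: E {B hB} => [|E IH]; first by [].
rewrite ffactnSr expnSr; apply: leq_mul => //; exact: leq_subr.
Qed.

End Partition.

(** * Graphs with a prescribed degree sequence *)

Section DegreeSequences.
Variables (V : finType) (t : V -> nat) (D E : nat).
Hypothesis tD : forall v, t v <= D.
Hypothesis sum_t : \sum_v t v = E.*2.
Implicit Types (S : {set {set V}}) (u v w x y : V).

Definition simple S := [forall e in S, #|e| == 2].

Definition sdegree S v := #|[set e in S | v \in e]|.

(** For [j = E] the deficits [t v - sdegree S v] sum to zero, so these are exactly the simple graphs
    with degree sequence [t]. *)
Definition partial_realizations j :=
  [set S : {set {set V}} |
    [&& simple S, [forall v, sdegree S v <= t v] & #|S| == j]].

Lemma sum_sdegree S : simple S -> \sum_v sdegree S v = #|S|.*2.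
Proof.
move=> /forall_inP S2; rewrite /sdegree.
under eq_bigr do rewrite -sum1dep_card big_mkcondr /=.
rewrite exchange_big /= -mul2n mulnC -sum_nat_const; apply: eq_bigr => e eS.
by rewrite -big_mkcondr /= sum1_card (eqP (S2 e eS)).
Qed.

Lemma sdegreeU1 S e v : e \notin S -> sdegree (e |: S) v = sdegree S v + (v \in e).
Proof.
move=> eS; rewrite /sdegree; case: (boolP (v \in e)) => ve.
  rewrite (_ : [set f in e |: S | v \in f] = e |: [set f in S | v \in f]).
    by rewrite cardsU1 inE (negbTE eS) addnC.
  by apply/finset.setP => f; rewrite !inE; case: eqP => // ->; rewrite ve.
rewrite addn0; apply: eq_card => f; rewrite !inE.
by case: eqP => // ->; rewrite (negbTE ve) !andbF.
Qed.

Lemma sdegreeD1 S e v : e \in S -> sdegree S v = sdegree (S :\ e) v + (v \in e).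
Proof. by move=> eS; rewrite -sdegreeU1 ?finset.setD1K ?setD11. Qed.

Lemma card_nbhd S u : #|[set v | [set u; v] \in S]| <= sdegree S u.
Proof.
rewrite -(card_imset _ (_ : injective (fun v => [set u; v]))).
  apply: subset_leq_card; apply/fintype.subsetP => e /imsetP[v].
  by rewrite !inE => uvS ->; rewrite uvS !inE eqxx.
move=> v w vw.
have : v \in [set u; w] by rewrite -vw !inE eqxx orbT.
have : w \in [set u; v] by rewrite vw !inE eqxx orbT.
by rewrite !inE => /orP[/eqP->|/eqP->] // /orP[|] /eqP.
Qed.

Lemma sum_deficit j S : S \in partial_realizations j ->
  \sum_v (t v - sdegree S v) = (E - j).*2.
Proof.
rewrite inE => /and3P[S2 /forallP St /eqP <-].
by rewrite sumnB // sum_t sum_sdegree // doubleB.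
Qed.

(** Double counts the pairs consisting of a graph with [j] edges and an extension of it by one edge:
    there are at least [(E - j) ^ 2 / (2 * D ^ 2)] extensions, while an extension arises from at
    most [j.+1] graphs. *)
Lemma leq_add_edge j : D ^ 2 <= E - j -> j < E ->
  (E - j) ^ 2 * #|partial_realizations j|
    <= (D ^ 2).*2 * j.+1 * #|partial_realizations j.+1|.
Proof.
move=> hD jE.
pose r S S' := [exists e in S', S == S' :\ e].
apply: (@leq_double_count _ _ _ _ r) => [S SA|S' S'A]; last first.
  have <- : #|S'| = j.+1 by move: S'A; rewrite inE => /and3P[_ _ /eqP].
  rewrite (leq_trans (subset_leq_card _) (leq_imset_card (fun e => S' :\ e) _)) //.
  apply/fintype.subsetP => S; rewrite inE => /andP[_ /exists_inP[e eS' /eqP->]].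
  exact: imset_f.
have [S2 St Sj] : [/\ simple S, forall v, sdegree S v <= t v & #|S| = j].
  by move: SA; rewrite inE => /and3P[S2 /forallP St /eqP Sj].
set A := [set S' in _ | _].
pose Z := [set v | sdegree S v < t v].
pose P := [set q : V * V | [&& q.1 \in Z, q.2 \in Z, q.1 != q.2 & [set q.1; q.2] \notin S]].
have PA : #|P| <= 4 * #|A|.
  (* The ordered pairs giving a fixed [uv] lie in [{u, v} * {u, v}], hence the 4. *)
  apply: (@leq_card_cover_by _ _ _ _ (fun q S' => S' == [set q.1; q.2] |: S)).
    move=> [u v]; rewrite !inE /= => /and4P[uZ vZ uv uvS].
    exists ([set u; v] |: S) => //; rewrite !inE; apply/andP; split; last first.
      apply/exists_inP; exists [set u; v]; first by rewrite !inE eqxx.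
      by rewrite setU1K.
    apply/and3P; split.
    - apply/forall_inP => e; rewrite !inE => /orP[/eqP->|]; first by rewrite cards2 uv.
      exact: (forall_inP S2).
    - apply/forallP => w; rewrite sdegreeU1 // !inE.
      case: eqP => [->|_] /=; first by rewrite addn1.
      by case: eqP => [->|_] /=; rewrite ?addn1 ?addn0.
    - by rewrite cardsU1 uvS Sj.
  move=> S' _.
  case: (pickP (mem [set q in P | S' == [set q.1; q.2] |: S])) => [[u v] | h]; last first.
    by rewrite (_ : [set _ in _ | _] = finset.set0) ?cards0 //;
      apply/finset.setP => q; rewrite [RHS]inE; exact: h.
  rewrite !inE /= => /andP[/and4P[_ _ uv uvS] /eqP ->].
  have <- : #|finset.setX [set u; v] [set u; v]| = 4 by rewrite cardsX cards2 uv.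
  apply: subset_leq_card; apply/fintype.subsetP => -[x y].
  rewrite [in X in X -> _]inE => /andP[]; rewrite inE /= => /and4P[_ _ _ xyS] /eqP h.
  have {}h : [set u; v] = [set x; y].
    apply/eqP; have : [set u; v] \in [set x; y] |: S by rewrite -h !inE eqxx.
    by rewrite in_setU1 (negbTE uvS) orbF.
  by rewrite inE /= h !inE !eqxx orbT.
have kZ : (E - j).*2 <= D * #|Z|.
  rewrite -(sum_deficit SA) mulnC -sum_nat_const [leqRHS]big_mkcond /=.
  apply: leq_sum => v _; rewrite inE; case: ifP => h.
    by rewrite (leq_trans (leq_subr _ _)).
  by rewrite leqn0 subn_eq0 leqNgt h.
have ZP : #|Z| * (#|Z| - D) <= #|P|.
  rewrite -[#|P|]sum1dep_card.
  rewrite -(pair_big_dep (mem Z)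
    (fun u v => [&& v \in Z, u != v & [set u; v] \notin S]) (fun _ _ => 1)) /=.
  rewrite -sum_nat_const; apply: leq_sum => u uZ; rewrite sum1dep_card.
  (* An unsaturated [u] has fewer than [D] neighbours, so together with itself it excludes at most
     [D] partners. *)
  have uD : sdegree S u < D by move: uZ; rewrite inE => /leq_trans ->.
  have : #|[set v | [set u; v] \in S] :|: [set u]| <= D.
    rewrite (leq_trans (leq_card_setU _ _)) // cards1 addn1 (leq_trans _ uD) //.
    by rewrite ltnS card_nbhd.
  move: (_ :|: _) (fun v => finset.in_setU v [set v | [set u; v] \in S] [set u]) => N Nv ND.
  apply: leq_trans (_ : #|Z| - #|N| <= _); first exact: leq_sub2l.
  rewrite leq_subLR addnC -(cardsID N Z) addnC leq_add ?subset_leq_card //.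
    by apply/fintype.subsetP => v; rewrite !inE Nv !inE negb_or;
      move=> /andP[/andP[-> ]]; rewrite eq_sym => -> ->.
  by apply/fintype.subsetP => v; rewrite inE => /andP[].
(* With [k = E - j], [kZ] and [D ^ 2 <= k] give [D * (#|Z| - D) >= k]; multiplying by
   [D * #|Z| >= 2 * k] yields [2 * k ^ 2 <= D ^ 2 * #|P| <= 4 * D ^ 2 * #|A|]. *)
nia.
Qed.

(** Close to completion the unsaturated vertices may all be adjacent or coincide, so no edge need be
    addable. A switch still gains one edge: [x] and [y] keep their degrees while [u] and [v] gain
    one each. The four vertices and the result determine the original graph, whence the factor
    [#|V| ^ 4]. *)
Lemma leq_switch j : j < E -> (D * D.+1).*2 < j ->
  #|partial_realizations j| <= #|V| ^ 4 * #|partial_realizations j.+1|.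
Proof.
move=> jE Dj.
(* [q = (u, v, (x, y))] records the switch that removes [xy], adds [ux] and [vy]. *)
pose undo (q : V * V * (V * V)) S' :=
  [set q.2.1; q.2.2] |: (S' :\ [set q.1.2; q.2.2] :\ [set q.1.1; q.2.1]).
pose r S S' := [exists q, S == undo q S'].
apply: (@leq_card_cover_by _ _ _ _ r) => [S SA|S' S'A]; last first.
  have <- : #|{: V * V * (V * V)}| = #|V| ^ 4 by rewrite !card_prod !expnS; lia.
  rewrite -cardsT.
  apply: leq_trans (leq_imset_card (fun q => undo q S') _).
  apply: subset_leq_card.
  apply/fintype.subsetP => S; rewrite inE => /andP[_ /existsP[q /eqP->]].
  exact: imset_f.
have [S2 St Sj] : [/\ simple S, forall v, sdegree S v <= t v & #|S| = j].
  by move: SA; rewrite inE => /and3P[S2 /forallP St /eqP Sj].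
have dS := sum_deficit SA.
have [u uP] : exists u, sdegree S u < t u.
  apply/existsP; apply: contraTT jE => /existsPn h.
  rewrite -leqNgt -subn_eq0 -double_eq0 -dS sum_nat_eq0.
  by apply/forall_inP => v _; rewrite subn_eq0 leqNgt.
(* The total deficit is even and positive, so one unit is left after [u] takes one; it may again be
   at [u]. *)
have [v uvP] : exists v, forall w, sdegree S w + (w == u) + (w == v) <= t w.
  have [v vP] : exists v, sdegree S v + (v == u) < t v.
    apply/existsP; rewrite -[[exists _, _]]negbK negb_exists.
    apply/negP => /forallP h.
    have : \sum_w (t w - sdegree S w) <= \sum_w (w == u).
      by apply: leq_sum => w _; rewrite leq_subLR leqNgt.
    rewrite dS (bigD1 u) //= eqxx big1 => [|w /negbTE -> //].
    by lia.
  exists v => w; case: (eqVneq w v) => [->|_]; first by rewrite addn1.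
  rewrite addn0; case: eqVneq => [->|_]; first by rewrite addn1.
  by rewrite addn0.
(* An edge avoiding both closed neighbourhoods is switchable, even if [u = v]. *)
pose N := u |: [set x | [set u; x] \in S] :|: (v |: [set y | [set v; y] \in S]).
have cN : #|N| <= D.+1.*2.
  rewrite (leq_trans (leq_card_setU _ _)) // -addnn leq_add //.
    rewrite cardsU1 -add1n leq_add ?leq_b1 // (leq_trans (card_nbhd _ _)) //.
    exact: leq_trans (St _) (tD _).
  rewrite cardsU1 -add1n leq_add ?leq_b1 // (leq_trans (card_nbhd _ _)) //.
  exact: leq_trans (St _) (tD _).
(* Each of the at most [2 * (D + 1)] vertices of [N] lies on at most [D] edges, and [S] has more
   edges than that allows. *)
have [e eS eN] : exists2 e, e \in S & [disjoint e & N].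
  apply/exists_inP; apply: contraTT Dj => /exists_inPn h; rewrite -leqNgt -Sj.
  apply: leq_trans (_ : D * #|N| <= _); last first.
    by rewrite doubleMr leq_mul2l cN orbT.
  apply: (@leq_card_cover_by _ _ _ _ (fun (e : {set V}) x => x \in e)) => [e eS|x _].
    have := h e eS; rewrite -setI_eq0 => /finset.set0Pn[x].
    by rewrite inE => /andP[xe xN]; exists x.
  exact: leq_trans (St x) (tD x).
have /cards2P[x [y [xy exy]]] := forall_inP S2 e eS.
move: eN; rewrite exy finset.disjoints_subset => /fintype.subsetP eN.
have := eN x; have := eN y; rewrite !inE !eqxx /= orbT !negb_or.
move=> /(_ isT)/andP[/andP[yu uyS] /andP[yv vyS]].
move=> /(_ isT)/andP[/andP[xu uxS] /andP[xv vxS]].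
have vx' : [set u; x] != [set v; y].
  apply: contraNneq xv => /setP /(_ x); rewrite !inE eqxx orbT (negbTE xy) orbF.
  by move/esym.
pose S' := [set u; x] |: ([set v; y] |: (S :\ e)).
have vyS' : [set v; y] \notin S :\ e by rewrite !inE (negbTE vyS) andbF.
have uxS' : [set u; x] \notin [set v; y] |: (S :\ e).
  by rewrite !inE (negbTE uxS) (negbTE vx') andbF.
exists S'; last first.
  apply/existsP; exists (u, v, (x, y)); rewrite /undo /=.
  apply/eqP/finset.setP => f; rewrite /S' !inE -exy.
  case: (eqVneq f e) => [-> //|_] /=.
  case: (eqVneq f [set u; x]) => [->|_] /=; first exact: negbTE.
  by case: (eqVneq f [set v; y]) => [->|_] //=; exact: negbTE.
rewrite inE; apply/and3P; split.
- apply/forall_inP => f; rewrite !inE => /or3P[/eqP->|/eqP->|/andP[_ fS]].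
  + by rewrite cards2 [u == x]eq_sym xu.
  + by rewrite cards2 [v == y]eq_sym yv.
  + exact: (forall_inP S2).
- apply/forallP => w; apply: leq_trans (uvP w).
  rewrite !sdegreeU1 // (sdegreeD1 w eS) exy !inE.
  case: (eqVneq w x) => [->|_].
    by rewrite (negbTE xu) (negbTE xv) (negbTE xy) /= !addn0.
  rewrite !orbF; case: (eqVneq w y) => [->|_].
    by rewrite (negbTE yu) (negbTE yv) /= !addn0.
  by rewrite orbF /= addn0 addnAC.
- by rewrite !cardsU1 vyS' uxS' -Sj (cardsD1 e S) eS.
Qed.

(** Telescopes [leq_add_edge] from the empty graph: the factors [(E - i) ^ 2] multiply to the square
    of [E! / (E - j)!], written without division. *)
Lemma leq_partial_realizations j : j + D ^ 2 <= E ->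
  E`! ^ 2 <= (#|partial_realizations j| * (D ^ 2).*2 ^ j * j`!) * ((E - j)`! ^ 2).
Proof.
elim: j => [|j IH] hj.
  rewrite expn0 !muln1 subn0 leq_pmull // card_gt0; apply/finset.set0Pn.
  exists finset.set0; rewrite inE cards0 eqxx andbT; apply/andP; split.
    by apply/forall_inP => e; rewrite inE.
  apply/forallP => v; rewrite (_ : sdegree _ _ = 0) //.
  by apply/eqP; rewrite cards_eq0; apply/eqP/setP => e; rewrite !inE.
have jE : j < E by lia.
apply: leq_trans (IH _) _; first lia.
have -> : (E - j)`! = (E - j) * (E - j.+1)`! by rewrite -(subnSK jE) factS.
have h : (E - j) ^ 2 * #|partial_realizations j|
    <= (D ^ 2).*2 * j.+1 * #|partial_realizations j.+1|.
  by apply: leq_add_edge => //; lia.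
rewrite expnMn factS [(D ^ 2).*2 ^ j.+1]expnS.
move: h; set a := #|partial_realizations j|; set b := #|partial_realizations j.+1|.
set c := (E - j) ^ 2; set d := (D ^ 2).*2.
set e := d ^ j; set f := (_ `! ^ 2) => h.
rewrite (_ : a * e * j`! * (c * f) = (c * a) * (e * j`! * f)); last lia.
rewrite (_ : b * (d * e) * (j.+1 * j`!) * f = d * j.+1 * b * (e * j`! * f)); last lia.
by rewrite leq_mul2r h orbT.
Qed.

(** Edges are added as long as [D ^ 2] are missing; the last [D ^ 2] come from switches, at a cost
    of [#|V| ^ 4] each. The lower bound on [E] keeps enough edges present for every switch. *)
Lemma leq_card_realizations : (D * D.+1).*2 + D ^ 2 < E ->
  E`! <= #|partial_realizations E| * #|V| ^ (4 * D ^ 2) * (D ^ 2).*2 ^ E * (D ^ 2)`!.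
Proof.
move=> hE; set K := D ^ 2 in hE *.
have hsw i : i <= K ->
    #|partial_realizations (E - K)| <= (#|V| ^ 4) ^ i * #|partial_realizations (E - K + i)|.
  elim: i => [|i IH] hi; first by rewrite expn0 mul1n addn0.
  apply: leq_trans (IH (ltnW hi)) _; rewrite [(#|V| ^ 4) ^ i.+1]expnSr -mulnA leq_mul2l addnS.
  by apply/orP; right; apply: leq_switch; lia.
have KE : K <= E by lia.
have := hsw K (leqnn _); rewrite subnK // -expnM => {}hsw.
have := @leq_partial_realizations (E - K); rewrite subnK // subKn // => /(_ (leqnn _)).
move=> h; move: hsw h.
have hf : (E - K)`! * K`! <= E`!.
  by rewrite -(bin_fact KE) [(E - K)`! * _]mulnC leq_pmull // bin_gt0.
have hp : (D ^ 2).*2 ^ (E - K) <= (D ^ 2).*2 ^ E.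
  case: (posnP D) => [D0|D0]; first by rewrite /K D0 subn0.
  by rewrite leq_pexp2l ?leq_subr // double_gt0 expn_gt0 D0.
set a := #|partial_realizations (E - K)|; set b := #|partial_realizations E|.
set c := #|V| ^ (4 * K); set d := (D ^ 2).*2 ^ (E - K) in hp *.
set p := (D ^ 2).*2 ^ E in hp *; set f := E`! in hf *.
set g := (E - K)`! in hf *; set k := K`! in hf * => hab h.
have f0 : 0 < f by exact: fact_gt0.
rewrite -(leq_pmul2l f0) mulnn (leq_trans h) //.
have h1 : a * d * g * k ^ 2 = (a * d) * (g * k) * k by rewrite -mulnn; lia.
rewrite h1 (_ : f * (b * c * p * k) = (c * b * p) * f * k); last lia.
by rewrite leq_mul // leq_mul // leq_mul.
Qed.

End DegreeSequences.

(** * Counting regular graphs *)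

(** Both sides are compared with the falling factorial of [2n]: it is at least [n ^ n], and it
    equals ['C(2n, n) * n!] with ['C(2n, n) <= 2 ^ (2n)]. *)
Lemma leq_expn_fact n : n ^ n <= 4 ^ n * n`!.
Proof.
have ffact_ge k m : k <= m -> (m - k) ^ k <= m ^_ k.
  elim: k m => [|k IH] [|m] // km; rewrite ffactnS expnS subSS leq_mul //.
    exact: leq_trans (leq_subr _ _) _.
  exact: IH.
have := ffact_ge n (n + n) (leq_addr n n); rewrite addnK -bin_ffact => h.
apply: leq_trans h _; rewrite leq_mul2r; apply/orP; right.
rewrite -[n + n]card_ord -card_draws (leq_trans (max_card _)) //.
by rewrite -cardsT -powersetT card_powerset cardsT card_ord addnn -mul2n expnM.
Qed.

Lemma leq_bin_expn n k : 'C(n, k) * k ^ k <= (4 * n) ^ k.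
Proof.
apply: leq_trans (_ : 'C(n, k) * (4 ^ k * k`!) <= _).
  by rewrite leq_mul2l leq_expn_fact orbT.
rewrite mulnCA bin_ffact expnMn leq_mul2l; apply/orP; right.
elim: k => // k IH; rewrite ffactnSr expnSr; apply: leq_mul => //.
exact: leq_subr.
Qed.

Section RegularCount.
Variables (R : realType) (rho : R) (n D E : nat).
Hypotheses (rho_ge0 : (0 <= rho)%R) (rho_le : (rho <= D%:R)%R).
Hypothesis hE : Num.ceil (rho * n%:R)%R = Posz E.*2.

(** One degree sequence with values the floor and the ceiling of [rho] already supplies enough
    graphs. *)
Lemma leq_card_regular : (D * D.+1).*2 + D ^ 2 < E ->
  E`! <= #|regular_graphs rho n| * n ^ (4 * D ^ 2) * (D ^ 2).*2 ^ E * (D ^ 2)`!.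
Proof.
move=> DE.
have [lo loE] : exists lo : nat, Num.floor rho = Posz lo.
  have : (0 <= Num.floor rho)%R by rewrite floor_ge0.
  by case: Num.floor => // lo _; exists lo.
have [hi hiE] : exists hi : nat, Num.ceil rho = Posz hi.
  have : (0 <= Num.ceil rho)%R by rewrite (@ceil_ge0 R rho) (lt_le_trans _ rho_ge0) // ltrN10.
  by case: Num.ceil => // hi _; exists hi.
have lole : (lo%:R <= rho)%R by have /andP[] := floor_itv rho; rewrite loE.
have hige : (rho <= hi%:R)%R by have := ceil_ge rho; rewrite hiE.
have hilo : hi <= lo.+1.
  by have := ceil_floor rho; rewrite loE hiE; case: (rho \isn't a Num.int) => /=; lia.
have lonE : lo * n <= E.*2.
  rewrite -(ler_nat R) natrM; have := ceil_ge (rho * n%:R); rewrite hE.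
  by apply: le_trans; rewrite ler_wpM2r.
have hinE : E.*2 <= hi * n.
  by rewrite -lez_nat -hE ceil_le_int -pmulrn natrM ler_wpM2r.
have hiD : hi <= D by rewrite -lez_nat -hiE ceil_le_int -pmulrn.
(* The first [E.*2 - lo * n] vertices take the larger degree. For integral [rho] this excess is 0,
   so [t] is constant. *)
pose t (v : 'I_n) := lo + (v < E.*2 - lo * n).
have tlohi v : (t v == lo) || (t v == hi).
  by rewrite /t; have := ltn_ord v; case: ltnP => /=; nia.
have tD v : t v <= D.
  have lohi : lo <= hi by rewrite -(ler_nat R) (le_trans lole).
  by rewrite (leq_trans _ hiD) //; case/orP: (tlohi v) => /eqP->.
have sum_t : \sum_v t v = E.*2.
  have dn : E.*2 - lo * n <= n by nia.
  rewrite big_split /= sum_nat_const card_ord mulnC -[RHS](subnKC lonE).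
  congr (_ + _); rewrite -[RHS]card_ord -[RHS]sum1_card.
  by rewrite (big_ord_widen n (fun _ => 1) dn) [RHS]big_mkcond.
apply: leq_trans (leq_card_realizations tD sum_t DE) _; rewrite card_ord.
rewrite !leq_mul //.
rewrite -(card_imset _ (val_inj : injective (val : sgraph 'I_n -> _))).
apply: subset_leq_card; apply/fintype.subsetP => S SA.
have := sum_deficit sum_t SA; rewrite subnn => /eqP.
rewrite sum_nat_eq0 => /forallP dS.
move: SA; rewrite inE => /and3P[S2 /forallP St /eqP SE].
apply/imsetP; exists (SGraph S2) => //.
rewrite inE /rho_regular /= SE hE eqxx andbT; apply/forallP => v.
have -> : degree (SGraph S2) v = t v.
  by apply/eqP; rewrite eqn_leq St /= -subn_eq0; have := dS v.
by rewrite loE hiE; exact: tlohi.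
Qed.

(** Multiplies the upper bound for compressible graphs by the lower bound for regular ones. The
    resulting square of [E!] is traded for [E ^ E.*2] at a cost of [16 ^ E]; with [2 * D ^ 2] per
    edge this makes [32 * D ^ 2]. *)
Lemma card_small_min_ordered_ramsey (M L m : nat) (P : pred (sgraph 'I_n)) :
  0 < L -> 0 < m -> 'C(n + M, n) < 2 ^ m -> (D * D.+1).*2 + D ^ 2 < E ->
  (forall G, ~~ P G -> min_ordered_ramsey G <= M.+1 * L) ->
  #|[set G in regular_graphs rho n | ~~ P G]| * E ^ E.*2
    <= #|regular_graphs rho n| * (M.+1 ^ (n + m.*2)
         * (32 * D ^ 2 * (m * L ^ 2)) ^ E * n ^ (4 * D ^ 2) * (D ^ 2)`!).
Proof.
move=> L0 m0 Cm DE PG; have rg := leq_card_regular DE.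
set B := [set G in _ | _].
have hB : #|B| * E`! <= M.+1 ^ (n + m.*2) * (m * L ^ 2) ^ E.
  have := @card_block_compressible 'I_n M L m E m0; rewrite card_ord.
  apply: leq_trans; rewrite leq_mul2r; apply/orP; right.
  rewrite -(card_imset _ (val_inj : injective (val : sgraph 'I_n -> _))).
  apply: subset_leq_card; apply/fintype.subsetP => S /imsetP[G].
  rewrite !inE => /andP[/andP[_ GE] /PG NG] ->; rewrite edges_card2 /=.
  apply/andP; split.
    by move: GE; rewrite hE => /eqP[]; lia.
  move: NG; rewrite /min_ordered_ramsey; case: ex_minnP => N.
  move=> /asboolP[OG OGE NE] _ NML; rewrite -OGE.
  apply: (@arrow_compressible _ _ _ _ OG N) => //; first by rewrite card_ord.
  by move: NE; rewrite /ordered_ramsey; case: ex_minnP => N' /asboolP h _ <-.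
have EE := leq_expn_fact E.
rewrite -addnn expnD (leq_trans (leq_mul (leqnn _) (leq_mul EE EE))) //.
rewrite (_ : 32 * D ^ 2 * (m * L ^ 2) = 4 * 4 * (D ^ 2).*2 * (m * L ^ 2)); last lia.
move: (m * L ^ 2) hB => K hB; rewrite !expnMn; move: hB rg.
set b := #|B|; set r := #|regular_graphs _ _|; set f := E`!.
set x := 4 ^ E; set y := K ^ E; set z := _ ^ (n + _).
set u := n ^ _; set v := _.*2 ^ E; set w := _`! => hb hr.
rewrite (_ : b * _ = (b * f) * f * (x * x)); last by ring.
rewrite (_ : r * _ = (z * y) * (r * u * v * w) * (x * x)); last by ring.
by rewrite leq_mul // leq_mul.
Qed.

End RegularCount.

(** * Asymptotics *)

Local Open Scope ring_scope.

(** Splits [ln x] as [ln (x / k) + ln k]; a large [k] makes the slope small. *)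
Lemma ln_le_affine (R : realType) (k x : R) : 0 < k -> 0 < x -> ln x <= x / k + k.
Proof.
move=> k0 x0; have xk : 0 < x / k by rewrite divr_gt0.
rewrite -{1}(divfK (lt0r_neq0 k0) x) lnM ?posrE // lerD // ltW //; exact: ln_sublinear.
Qed.

Lemma ln2_ge_half (R : realType) : 1 / 2 <= ln 2 :> R.
Proof.
have := @le_ln1Dx R (- (1 / 2)); rewrite (_ : 1 + _ = 2^-1); last by field.
rewrite lnV ?posrE //; lra.
Qed.

Lemma expR_ln_nat (R : realType) (x : R) (k : nat) :
  0 < x -> x ^+ k = expR (k%:R * ln x).
Proof. by move=> x0; rewrite expRM_natl lnK. Qed.

(** The binomial is at most [(16 * s ^+ 3) ^+ M], whose logarithm is of order [M * ln s], whereas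
    [m] is about [M * s]. Later [s] is the square root of [ln n]. *)
Lemma bin_truncn_lt (R : realType) (n : nat) (s : R) :
  let M := Num.truncn (n%:R / s ^+ 3) in let m := Num.truncn (n%:R / s ^+ 2) in
  800 <= s -> 2 * s ^+ 3 <= n%:R -> ('C(n + M, n) < 2 ^ m)%N.
Proof.
move=> M m s_ge n_ge.
have s0 : 0 < s by lra.
have [s20 s30] : 0 < s ^+ 2 /\ 0 < s ^+ 3 by split; exact: exprn_gt0.
have [x xE] : exists x, x = n%:R / s ^+ 3 by eexists.
have nE : n%:R = x * s ^+ 3 by rewrite xE divfK ?lt0r_neq0.
have x2 : 2 <= x by rewrite xE ler_pdivlMr.
have Mx : M%:R <= x by rewrite xE truncn_le -xE (le_trans _ x2).
have xM : x < M%:R + 1 by rewrite natr1 xE truncnS_gt.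
have M0 : 0 < M%:R :> R by lra.
have s1 : 1 <= s by lra.
have xm : x * s < m%:R + 1.
  rewrite natr1 (_ : x * s = n%:R / s ^+ 2) ?truncnS_gt //.
  by rewrite nE; field; rewrite lt0r_neq0.
have Cb : ('C(n + M, n))%:R <= (16 * s ^+ 3) ^+ M :> R.
  rewrite -(ler_pM2r (exprn_gt0 M M0)) -exprMn.
  have := leq_bin_expn (n + M) M; rewrite -bin_sub ?leq_addl // addnK.
  rewrite -(ler_nat R) natrM !natrX natrM natrD => /le_trans; apply.
  apply: lerXn2r; rewrite ?nnegrE; [by rewrite mulr_ge0|by rewrite !mulr_ge0 // ltW|].
  rewrite nE.
  have : x * s ^+ 3 <= 2 * M%:R * s ^+ 3 by rewrite ler_wpM2r ?ltW //; lra.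
  have : 1 * M%:R <= s ^+ 3 * M%:R.
    rewrite ler_wpM2r ?(ltW M0) //; exact: exprn_ege1.
  lra.
rewrite -(ltr_nat R) natrX; apply: le_lt_trans Cb _.
have h16 : 0 < 16 * s ^+ 3 by rewrite mulr_gt0.
rewrite [_ ^+ M]expR_ln_nat // [_ ^+ m]expR_ln_nat // ltr_expR lnM ?posrE // lnXn //.
have l16 : ln 16 <= 16 :> R by rewrite ltW ?ln_sublinear.
have ls : ln s <= s / 24 + 24 by apply: ln_le_affine.
have l2 := ln2_ge_half R.
(* The left side is at most [s / 8 + 88], and [88 <= 0.115 * s] once [s >= 800]. *)
have h1 : ln 16 + ln s *+ 3 <= 24 / 100 * s by lra.
have h2 : M%:R * (ln 16 + ln s *+ 3) <= x * (24 / 100 * s).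
  apply: le_trans (ler_wpM2l (ltW M0) h1) _; rewrite ler_wpM2r //; lra.
have h3 : m%:R * (1 / 2) <= m%:R * ln 2 :> R by rewrite ler_wpM2l.
have h4 : 2 * s <= x * s by rewrite ler_wpM2r // ltW.
lra.
Qed.

(** The hypothesis [h] forces [y <= 0], so [E] may be replaced by its lower bound [n * rho / 2]. The
    term [n * b] then cancels, and [128 * D] outweighs the remaining multiples of [n]. *)
Lemma first_moment_exponent (R : realFieldType) (n m E D b y rho K : R) :
  0 < n -> 0 < b -> 4 <= D -> 2 <= rho -> n * (rho / 2) <= E ->
  m * b <= n -> K <= n -> 128 * D + b + rho / 2 * y <= 0 ->
  (n + 2 * m) * b + E * y + K <= - n.
Proof.
move=> n0 b0 D4 rho2 nE mb Kn h.
have y0 : y <= 0.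
  have r0 : 0 < rho / 2 by lra.
  by rewrite -(pmulr_rle0 _ r0); lra.
have h1 : E * y <= n * (rho / 2) * y by rewrite ler_wnM2r.
have h2 : n * (rho / 2 * y) <= n * - (b + 128 * D) by rewrite ler_wpM2l ?(ltW n0) //; lra.
have h3 : n * 4 <= n * D by rewrite ler_wpM2l ?(ltW n0).
lra.
Qed.

(** The first moment bound for a single [n]. In the last hypothesis each vertex costs [ln n] for the
    choice of its block and gains [rho / 2] edges, each contributing the logarithm of its factor in
    the quotient of counts. *)
Lemma min_ordered_ramsey_prob_ge (R : realType) (rho B s : R) (n D E : nat) :
  800 <= s -> 2 * s ^+ 3 <= n%:R -> ln n%:R = s ^+ 2 ->
  2 <= rho -> rho <= D%:R -> Num.ceil (rho * n%:R) = Posz E.*2 ->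
  ((D * D.+1).*2 + D ^ 2 < n)%N ->
  (4 * D ^ 2)%N%:R * ln n%:R + ln (D ^ 2)`!%:R <= n%:R :> R ->
  n%:R <= B * s ^+ 3 ->
  128 * D%:R ^+ 2 + ln n%:R + rho / 2 * (ln (128 * D%:R ^+ 2)
    + 2 * ln (ln n%:R) + 2 * ln B - 3 * ln n%:R) <= 0 ->
  1 - expR (- n%:R) <=
    random_regular_prob rho (fun G : sgraph 'I_n => B <= (min_ordered_ramsey G)%:R).
Proof.
move=> s_ge n_ge ln_n rho_ge2 rho_le hE n_large n_dom hB entropy.
pose M := Num.truncn (n%:R / s ^+ 3); pose m := Num.truncn (n%:R / s ^+ 2).
have s0 : 0 < s by lra.
have [s20 s30] : 0 < s ^+ 2 /\ 0 < s ^+ 3 by split; exact: exprn_gt0.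
have D2 : 2 <= D%:R :> R by lra.
have D4 : 4 <= D%:R ^+ 2 :> R by have := ler_pM _ _ D2 D2; rewrite -expr2; lra.
have s3big : 8 <= s ^+ 3.
  have -> : 8 = 2 ^+ 3 :> R by ring.
  by apply: lerXn2r; rewrite ?nnegrE; lra.
have n0 : 0 < n%:R :> R by lra.
have B0 : 0 < B by move: (lt_le_trans n0 hB); rewrite pmulr_lgt0.
have En : n%:R * (rho / 2) <= E%:R.
  by have := ceil_ge (rho * n%:R); rewrite hE -pmulrn -mul2n natrM; lra.
have nE : n%:R <= E%:R :> R.
  by apply: le_trans En; rewrite ler_peMr ?(ltW n0) //; lra.
have DE : ((D * D.+1).*2 + D ^ 2 < E)%N.
  by apply: leq_trans n_large _; rewrite -(ler_nat R).
(* Chosen so that [M.+1 * L] exceeds [B]; rounding up at most doubles it because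
   [n <= B * s ^+ 3]. *)
pose L := (Num.truncn (B * s ^+ 3 / n%:R)).+1.
pose P (G : sgraph 'I_n) : bool := B <= (min_ordered_ramsey G)%:R.
have m1 : (0 < m)%N.
  rewrite /m truncn_gt0 ler_pdivlMr // mul1r; apply: le_trans n_ge.
  have : 1 * s ^+ 2 <= s * s ^+ 2 by rewrite ler_wpM2r ?ltW //; lra.
  by rewrite -exprS; lra.
have mle : m%:R <= n%:R / s ^+ 2 by rewrite truncn_le divr_ge0 ?ltW.
have MS : n%:R / s ^+ 3 < M.+1%:R by exact: truncnS_gt.
have Mn : M.+1%:R <= n%:R :> R.
  have : M%:R <= n%:R / s ^+ 3 by rewrite truncn_le divr_ge0 ?ltW.
  have : n%:R / s ^+ 3 <= n%:R / 8.
    by rewrite ler_wpM2l ?(ltW n0) // lef_pV2 ?posrE //; lra.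
  by rewrite -[M.+1%:R]natr1; lra.
have bs1 : 1 <= B * s ^+ 3 / n%:R by rewrite ler_pdivlMr // mul1r.
have Llow : B * s ^+ 3 / n%:R < L%:R by exact: truncnS_gt.
have Lup : L%:R <= 2 * (B * s ^+ 3 / n%:R).
  have : (Num.truncn (B * s ^+ 3 / n%:R))%:R <= B * s ^+ 3 / n%:R.
    by rewrite truncn_le (le_trans _ bs1).
  by rewrite -[L%:R]natr1; lra.
have PG G : ~~ P G -> (min_ordered_ramsey G <= M.+1 * L)%N.
  rewrite -ltNge => NB; rewrite -(ler_nat R) natrM ltW // (lt_le_trans NB) //.
  rewrite (_ : B = n%:R / s ^+ 3 * (B * s ^+ 3 / n%:R)); last first.
    by field; rewrite !lt0r_neq0.
  by apply: ler_pM; rewrite ?ltW ?divr_gt0 ?mulr_gt0.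
have rho0 : 0 <= rho by lra.
(* Positivity of [E!] in the lower count excludes the degenerate quotient by zero. *)
have reg0 : (0 < #|regular_graphs rho n|)%N.
  have := leq_card_regular rho0 rho_le hE DE; rewrite lt0n.
  by apply: contraTneq => ->; rewrite !mul0n -ltnNge fact_gt0.
have := card_small_min_ordered_ramsey rho0 rho_le hE (ltn0Sn _ : (0 < L)%N) m1
  (bin_truncn_lt s_ge n_ge) DE PG.
rewrite /random_regular_prob -/P.
set b := #|[set G in _ | ~~ P G]|; set r := #|regular_graphs rho n| in reg0 *.
have rE : (r = #|[set G in regular_graphs rho n | P G]| + b)%N.
  rewrite /r -(cardsID [set G | P G]); congr (_ + _)%N; apply: eq_card => G.
    by rewrite !inE.
  by rewrite !inE andbC.
have r0 : 0 < r%:R :> R by rewrite ltr0n.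
move=> hb; rewrite (_ : #|_|%:R = r%:R - b%:R); last by rewrite rE natrD addrK.
rewrite mulrBl divff ?lt0r_neq0 // lerD2l lerN2 ler_pdivrMr //.
have E0 : 0 < E%:R :> R by lra.
rewrite -(ler_pM2r (exprn_gt0 E.*2 E0)).
move: hb; rewrite -(ler_nat R) !natrM natrX => /le_trans; apply.
rewrite [X in _ <= X]mulrAC [X in _ <= X]mulrC ler_wpM2l ?(ltW r0) //.
rewrite !natrX (natrM _ (32 * D ^ 2)) (natrM _ 32) (natrM _ m) !natrX.
(* [Y] bounds [32 D^2 m L^2 / E^2], the factor that each edge contributes. *)
pose Y := 128 * D%:R ^+ 2 * (ln n%:R) ^+ 2 * B ^+ 2 / n%:R ^+ 3.
have lnn0 : 0 < ln n%:R :> R by rewrite ln_n.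
have D0 : 0 < D%:R :> R by lra.
have Y0 : 0 < Y by rewrite divr_gt0 ?mulr_gt0 ?exprn_gt0.
have lnY : ln Y = ln (128 * D%:R ^+ 2) + 2 * ln (ln n%:R) + 2 * ln B - 3 * ln n%:R.
  rewrite /Y ln_div ?posrE ?mulr_gt0 ?exprn_gt0 //.
  rewrite lnM ?posrE ?mulr_gt0 ?exprn_gt0 //.
  rewrite [ln (_ * ln _ ^+ 2)]lnM ?posrE ?mulr_gt0 ?exprn_gt0 //.
  rewrite !lnXn //; lra.
have hY : 32 * D%:R ^+ 2 * (m%:R * L%:R ^+ 2) <= Y * E%:R ^+ 2.
  have h1 : m%:R * L%:R ^+ 2 <= n%:R / s ^+ 2 * (2 * (B * s ^+ 3 / n%:R)) ^+ 2.
    rewrite ler_pM ?exprn_ge0 // lerXn2r ?nnegrE //; lra.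
  have h2 : Y * n%:R ^+ 2 <= Y * E%:R ^+ 2.
    by rewrite ler_wpM2l ?(ltW Y0) // lerXn2r ?nnegrE ?(ltW n0) ?(ltW E0).
  apply: le_trans h2.
  have -> : Y * n%:R ^+ 2 = 32 * D%:R ^+ 2 * (n%:R / s ^+ 2 * (2 * (B * s ^+ 3 / n%:R)) ^+ 2).
    by rewrite /Y ln_n; field; rewrite !lt0r_neq0.
  by rewrite ler_wpM2l // mulr_ge0 ?exprn_ge0 // ltW.
have h1 : M.+1%:R ^+ (n + m.*2) <= expR ((n + m.*2)%:R * ln n%:R) :> R.
  by rewrite -(expR_ln_nat (n + m.*2) n0) lerXn2r ?nnegrE // ltW.
have h2 : (32 * D%:R ^+ 2 * (m%:R * L%:R ^+ 2)) ^+ E <= expR (E%:R * ln Y) * E%:R ^+ E.*2.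
  rewrite -mul2n exprM -(expR_ln_nat E Y0) -exprMn lerXn2r ?nnegrE //.
  by rewrite mulr_ge0 ?exprn_ge0 // ltW.
have h3 : n%:R ^+ (4 * D ^ 2) = expR ((4 * D ^ 2)%N%:R * ln n%:R) :> R.
  by rewrite expR_ln_nat.
have h4 : (D ^ 2)`!%:R = expR (ln (D ^ 2)`!%:R) :> R.
  by rewrite lnK // posrE ltr0n fact_gt0.
rewrite h3 [X in _ * X <= _]h4.
apply: (@le_trans _ _ (expR ((n + m.*2)%:R * ln n%:R) * (expR (E%:R * ln Y) * E%:R ^+ E.*2)
   * expR ((4 * D ^ 2)%N%:R * ln n%:R) * expR (ln (D ^ 2)`!%:R))).
  do 2 (apply: ler_wpM2r; first exact: expR_ge0).
  by apply: ler_pM => //; rewrite ?exprn_ge0 ?mulr_ge0 ?exprn_ge0.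
rewrite mulrA -!mulrA [E%:R ^+ _ * _]mulrC !mulrA ler_wpM2r ?exprn_ge0 //.
rewrite -!expRD ler_expR.
have mb : m%:R * ln n%:R <= n%:R :> R by rewrite ln_n -ler_pdivlMr.
apply: le_trans (first_moment_exponent n0 lnn0 D4 rho_ge2 En mb n_dom _).
  by rewrite -mul2n natrD natrM !addrA.
by rewrite lnY.
Qed.

(** * Reduction to inequalities between logarithms *)

Section Asymptotics.
Variable R : realType.
Local Open Scope classical_set_scope.

Lemma near_ge_ln (K : R) : \forall n \near \oo, K <= ln n%:R.
Proof.
apply: filterS (nbhs_infty_ger (expR K)) => n Kn.
have n0 : 0 < n%:R :> R by apply: lt_le_trans Kn; exact: expR_gt0.
by rewrite -ler_expR lnK.
Qed.

Lemma near_ge_ln_log2 (K : R) : \forall n \near \oo, K <= ln (log2 n%:R).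
Proof.
apply: filterS (near_ge_ln (ln 2 * expR K)) => n Kn.
have l2 : 0 < ln 2 :> R by rewrite ln_gt0 // ltr1n.
have h : expR K <= log2 n%:R by rewrite /log2 ler_pdivlMr // mulrC.
have l0 : 0 < log2 n%:R :> R by apply: lt_le_trans h; exact: expR_gt0.
by rewrite -ler_expR lnK.
Qed.

Lemma random_regular_prob_le1 (rho : R) (n : nat) (P : pred (sgraph 'I_n)) :
  random_regular_prob rho P <= 1.
Proof.
rewrite /random_regular_prob.
set a := #|_|; set b := #|_|.
have ab : (a <= b)%N.
  by apply: subset_leq_card; apply/fintype.subsetP => G; rewrite !inE => /andP[].
case: (posnP b) => [->|b0]; first by rewrite invr0 mulr0.
by rewrite ler_pdivrMr ?ltr0n // mul1r ler_nat.
Qed.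

(** Quantifying over every [C] absorbs the constant [128 * D ^ 2]. The condition with [3 / 2] is the
    logarithm of [n <= B * s ^+ 3] for [s] the square root of [ln n]. *)
Lemma aas_min_ordered_ramsey_ge (rho B : nat -> R) (D : nat) :
  (0 < D)%N ->
  (\forall n \near \oo, 2 <= rho n <= D%:R) ->
  (\forall n \near \oo, 0 < B n) ->
  (\forall n \near \oo, ln n%:R <= ln (B n) + 3 / 2 * ln (ln n%:R)) ->
  (forall C : R, 1 <= C -> \forall n \near \oo, C + ln n%:R + rho n / 2 *
     (ln C + 2 * ln (ln n%:R) + 2 * ln (B n) - 3 * ln n%:R) <= 0) ->
  random_regular_aas rho (fun n G => B n <= (min_ordered_ramsey G)%:R).
Proof.
move=> D0 hrho hB0 hB hC; rewrite /random_regular_aas.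
have C1 : 1 <= 128 * D%:R ^+ 2 :> R.
  have : 1 <= D%:R ^+ 2 :> R by rewrite exprn_ege1 // ler1n.
  lra.
apply/cvgrPdist_le => e e0; rewrite near_withinE.
pose K := `|ln (D ^ 2)`!%:R| : R.
(* The threshold for [s], kept symbolic so that [c ^+ 2] stays unexpanded. *)
have [c c0 cE] : exists2 c : R, 0 < c & c = 800 by exists 800; rewrite ?ltr0n.
near=> n => /= even_n.
have Rge : 1 - expR (- n%:R) <= random_regular_prob (rho n)
    (fun G : sgraph 'I_n => B n <= (min_ordered_ramsey G)%:R).
  have lnn_big : c ^+ 2 <= ln n%:R :> R by near: n; exact: near_ge_ln.
  have lnn_K : 8 * D%:R ^+ 2 + 2 * K + 1 <= ln n%:R by near: n; exact: near_ge_ln.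
  have /andP[rho2 rhoD] : 2 <= rho n <= D%:R by near: n.
  have B0 : 0 < B n by near: n.
  have lnB : ln n%:R <= ln (B n) + 3 / 2 * ln (ln n%:R) by near: n.
  have n0 : 0 < n%:R :> R.
    by rewrite ltr0n; near: n; exact: nbhs_infty_gt.
  pose s : R := Num.sqrt (ln n%:R).
  have b0 : 0 < ln n%:R :> R by apply: lt_le_trans lnn_big; rewrite exprn_gt0.
  have sE : ln n%:R = s ^+ 2 by rewrite sqr_sqrtr // ltW.
  have s800 : 800 <= s.
    by rewrite -cE -[c]ger0_norm ?(ltW c0) // -sqrtr_sqr ler_wsqrtr.
  (* A quadratic lower bound in [ln n] suffices: [s ^+ 4 / 2] beats [2 * s ^+ 3], and
     [ln n ^+ 2 / 2] beats the polynomial factor's logarithm. *)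
  have nexp : 1 + ln n%:R ^+ 2 / 2 <= n%:R :> R.
    by rewrite -[leRHS]lnK //; apply: (expR_ge1Dxn 1); exact: ltW.
  have [E hE] : exists E, Num.ceil (rho n * n%:R) = Posz E.*2.
    have : 0 <= Num.ceil (rho n * n%:R).
      rewrite ceil_ge0; apply: (@lt_le_trans _ _ 0); first by rewrite ltrN10.
      by rewrite mulr_ge0 //; lra.
    move: even_n => /=; case: Num.ceil => // k; rewrite dvdzE /= => k2 _.
    by exists k./2; rewrite even_halfK // -dvdn2.
  apply: (@min_ordered_ramsey_prob_ge R _ _ s n D E) => //.
  - apply: le_trans nexp; rewrite sE -exprM.
    have : 800 * s ^+ 3 <= s * s ^+ 3 by rewrite ler_wpM2r // exprn_ge0 //; lra.
    rewrite -exprS; have : 0 <= s ^+ 3 by rewrite exprn_ge0 //; lra.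
    lra.
  - by near: n; exact: nbhs_infty_gt.
  - have kK : ln (D ^ 2)`!%:R <= K := ler_norm _.
    have K0 : 0 <= K := normr_ge0 _.
    rewrite natrM natrX; apply: le_trans nexp.
    have h : (8 * D%:R ^+ 2 + 2 * K + 1) * ln n%:R <= ln n%:R * ln n%:R.
      by rewrite ler_wpM2r // ltW.
    have b1 : 1 <= ln n%:R :> R.
      have := exprn_ge0 2 (ler0n R D); lra.
    have : K * 1 <= K * ln n%:R by rewrite ler_wpM2l.
    rewrite expr2; lra.
  - have s0 : 0 < s by lra.
    rewrite -[leLHS]lnK // -[leRHS]lnK ?posrE ?mulr_gt0 ?exprn_gt0 //.
    rewrite ler_expR lnM ?posrE ?exprn_gt0 // lnXn //.
    by move: lnB; rewrite {2}sE lnXn //; lra.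
  - by near: n; exact: hC.
have ene : expR (- n%:R) <= e.
  rewrite -[leRHS]lnK // ler_expR lerNl; near: n; exact: nbhs_infty_ger.
have := @random_regular_prob_le1 (rho n) n (fun G => B n <= (min_ordered_ramsey G)%:R).
move=> h1; rewrite ger0_norm; lra.
Unshelve. all: by end_near.
Qed.

Lemma ln_ln2_itv : -1 <= ln (ln 2 : R) <= 0.
Proof.
have := ln2_ge_half R; have l2 : ln 2 <= 1 :> R.
  by have := @le_ln1Dx R 1; rewrite (_ : 1 + 1 = 2) //; apply; lra.
move=> h2; have l0 : 0 < ln 2 :> R by lra.
apply/andP; split; last by rewrite -ln1 ler_ln ?posrE.
have : ln (2^-1) <= ln (ln 2) :> R by rewrite ler_ln ?posrE //; lra.
rewrite lnV ?posrE //; lra.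
Qed.

(** * Natural and binary iterated logarithms *)

Section LogEstimates.
Variables (x a : R).
Hypotheses (aE : a = ln (log2 x)) (a_ge : 100 <= a) (x_gt1 : 1 < x).

Lemma log2_gt0 : 0 < log2 x.
Proof. by rewrite divr_gt0 // ln_gt0 // ltr1n. Qed.

Lemma ln_ln : ln (ln x) = a + ln (ln 2).
Proof.
have l2 : 0 < ln 2 :> R by rewrite ln_gt0 // ltr1n.
by rewrite aE -lnM ?posrE ?log2_gt0 // divfK ?lt0r_neq0.
Qed.

Lemma log2_log2_gt0 : 0 < log2 (log2 x).
Proof.
rewrite /log2 -/(log2 x) -aE divr_gt0 //; last by rewrite ln_gt0 // ltr1n.
by apply: lt_le_trans a_ge; rewrite ltr0n.
Qed.

Lemma ln_log2_log2 : ln (log2 (log2 x)) = ln a - ln (ln 2).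
Proof.
have ag := a_ge; have a0 : 0 < a by lra.
by rewrite [log2 (log2 x)]/log2 -aE ln_div ?posrE // ln_gt0 // ltr1n.
Qed.

(** Writes [ln x] as [ln 2 * expR a] and keeps the cubic term of the exponential series. *)
Lemma sqr_ln_log2_le : a ^+ 2 <= ln x.
Proof.
have ag := a_ge; have l2 := ln2_ge_half R; have l0 : 0 < ln 2 :> R by lra.
have -> : ln x = ln 2 * expR a by rewrite aE lnK ?posrE ?log2_gt0 // mulrC divfK ?lt0r_neq0.
have a0 : 0 <= a by lra.
have h : a ^+ 3 / 6 <= expR a by have := expR_ge1Dxn 2 a0; rewrite (_ : 3`!%:R = 6) //; lra.
have h1 : 1 / 2 * (a ^+ 3 / 6) <= ln 2 * expR a.
  by apply: ler_pM => //; rewrite divr_ge0 // exprn_ge0; lra.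
apply: le_trans h1; rewrite exprS.
have : 100 * a ^+ 2 <= a * a ^+ 2 by rewrite ler_wpM2r // sqr_ge0.
have := sqr_ge0 a; lra.
Qed.

End LogEstimates.
End Asymptotics.

(** * The two degree regimes *)

(** The exponent [3 / 2 - 1 / rho] makes the [ln n] terms cancel exactly, and [log2 n] in the
    denominator cancels [ln (ln n)] up to a constant. The factor [log2 (log2 n)] leaves a term
    tending to minus infinity, which absorbs [C]. *)
Lemma aas_fixed_degree (R : realType) (rho : R) : 2 < rho ->
  random_regular_aas (fun _ : nat => rho) (fun (n : nat) (G : sgraph 'I_n) =>
    n%:R `^ (3 / 2 - 1 / rho) / (4 * log2 n%:R * log2 (log2 n%:R))
      <= (min_ordered_ramsey G)%:R).
Proof.
move=> rho2; have rho0 : 0 < rho by lra.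
have lnB (n : nat) : (100 <= ln (log2 n%:R) :> R) -> (1 < n%:R :> R) ->
    0 < n%:R `^ (3 / 2 - 1 / rho) / (4 * log2 n%:R * log2 (log2 n%:R)) /\
    ln (n%:R `^ (3 / 2 - 1 / rho) / (4 * log2 n%:R * log2 (log2 n%:R)))
      = (3 / 2 - 1 / rho) * ln n%:R
        - (ln 4 + ln (log2 n%:R) + (ln (ln (log2 n%:R)) - ln (ln 2))).
  move=> a100 n1; have l0 := log2_gt0 n1.
  have ll0 := log2_log2_gt0 erefl a100.
  have p0 : 0 < n%:R `^ (3 / 2 - 1 / rho) by apply: powR_gt0; lra.
  have l1 : 0 < 4 * log2 n%:R :> R by apply: mulr_gt0.
  have l2 : 0 < 4 * log2 n%:R * log2 (log2 n%:R) :> R by apply: mulr_gt0.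
  split; first by rewrite divr_gt0.
  rewrite ln_div ?posrE // ln_powR lnM ?posrE //.
  by rewrite lnM ?posrE // (ln_log2_log2 erefl).
apply: (@aas_min_ordered_ramsey_ge R _ _ (Num.truncn rho).+1) => //.
- by near=> n; rewrite (ltW rho2) ltW // truncnS_gt.
- near=> n; have [||] // := lnB n.
  + by near: n; exact: near_ge_ln_log2.
  + by rewrite ltr1n; near: n; exact: nbhs_infty_gt.
- near=> n.
  have n1 : 1 < n%:R :> R by rewrite ltr1n; near: n; exact: nbhs_infty_gt.
  have a100 : 100 <= ln (log2 n%:R) :> R by near: n; exact: near_ge_ln_log2.
  have [_ ->] := lnB n a100 n1; rewrite (ln_ln erefl n1).
  have /andP[q1 q0] := ln_ln2_itv R.
  have l4 : ln 4 <= 4 :> R by rewrite ltW ?ln_sublinear.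
  have la : ln (ln (log2 n%:R)) <= ln (log2 n%:R) / 4 + 4 :> R.
    by apply: ln_le_affine => //; lra.
  have h : 1 * ln n%:R <= (3 / 2 - 1 / rho) * ln n%:R :> R.
    rewrite ler_wpM2r ?ln_ge0 ?(ltW n1) //.
    have : 1 / rho <= 1 / 2 by rewrite !div1r lef_pV2 ?posrE //; lra.
    lra.
  lra.
- move=> C C1; near=> n.
  have n1 : 1 < n%:R :> R by rewrite ltr1n; near: n; exact: nbhs_infty_gt.
  have a100 : 100 <= ln (log2 n%:R) :> R by near: n; exact: near_ge_ln_log2.
  have [_ ->] := lnB n a100 n1; rewrite (ln_ln erefl n1).
  have /andP[q1 q0] := ln_ln2_itv R.
  have l4 : 0 <= ln 4 :> R by rewrite ln_ge0 // ler1n.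
  have lC : 0 <= ln C by rewrite ln_ge0.
  have aC : C + ln C <= ln (ln (log2 n%:R)).
    have aC' : expR (C + ln C) <= ln (log2 n%:R) by near: n; exact: near_ge_ln_log2.
    by rewrite -ler_expR lnK // posrE; lra.
  set b := ln n%:R; set a := ln (log2 n%:R) in a100 aC *.
  set p := ln a in aC *; set q := ln (ln 2) in q1 q0 *.
  rewrite (_ : C + b + _ = C + rho / 2 * (ln C + 2 * q - 2 * ln 4 - 2 * (p - q))); last first.
    by field; rewrite lt0r_neq0.
  have h : rho / 2 * (ln C + 2 * q - 2 * ln 4 - 2 * (p - q)) <= rho / 2 * - C.
    by rewrite ler_wpM2l //; lra.
  have : 1 * C <= rho / 2 * C by rewrite ler_wpM2r //; lra.
  lra.
Unshelve. all: by end_near.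
Qed.

(** With [a = ln (log2 n)] and [r = a / ln n], the degree is [2 + 9 * r]. Its excess over 2
    contributes [- 9 / 2 * a], which beats the [4 * a] coming from [ln (ln n)] and [ln B]; this is
    where 9 suffices. *)
Lemma aas_near_two (R : realType) :
  random_regular_aas
    (fun n : nat => 2 + 9 * log2 (log2 n%:R) / log2 n%:R : R)
    (fun (n : nat) (G : sgraph 'I_n) =>
      n%:R * log2 n%:R / (2 * log2 (log2 n%:R)) <= (min_ordered_ramsey G)%:R :> R).
Proof.
have l2 : 0 < ln 2 :> R by rewrite ln_gt0 // ltr1n.
have lnB (n : nat) : (100 <= ln (log2 n%:R) :> R) -> (1 < n%:R :> R) ->
    0 < n%:R * log2 n%:R / (2 * log2 (log2 n%:R)) :> R /\
    ln (n%:R * log2 n%:R / (2 * log2 (log2 n%:R))) = ln n%:R + ln (log2 n%:R)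
      - (ln 2 + (ln (ln (log2 n%:R)) - ln (ln 2))) :> R.
  move=> a100 n1; have l0 := log2_gt0 n1.
  have ll0 := log2_log2_gt0 erefl a100.
  have n0 : 0 < n%:R :> R by lra.
  have l1 : 0 < n%:R * log2 n%:R :> R by apply: mulr_gt0.
  have l3 : 0 < 2 * log2 (log2 n%:R) :> R by apply: mulr_gt0.
  split; first by rewrite divr_gt0.
  rewrite ln_div ?posrE // lnM ?posrE // lnM ?posrE //.
  by rewrite (ln_log2_log2 erefl).
have rhoE (n : nat) : (1 < n%:R :> R) ->
    9 * log2 (log2 n%:R) / log2 n%:R = 9 * (ln (log2 n%:R) / ln n%:R) :> R.
  move=> n1; have b0 : 0 < ln n%:R :> R by rewrite ln_gt0.
  rewrite {1 3}/log2 /log2; field.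
  by rewrite !lt0r_neq0.
have ratio (n : nat) : (100 <= ln (log2 n%:R) :> R) -> (1 < n%:R :> R) ->
    0 <= ln (log2 n%:R) / ln n%:R :> R /\
    ln (log2 n%:R) / ln n%:R * ln (log2 n%:R) <= 1 :> R.
  move=> a100 n1; have b0 : 0 < ln n%:R :> R by rewrite ln_gt0.
  have hab := sqr_ln_log2_le erefl a100 n1.
  split; first by rewrite divr_ge0 ?(ltW b0) //; lra.
  by rewrite mulrAC ler_pdivrMr // mul1r -expr2.
apply: (@aas_min_ordered_ramsey_ge R _ _ 3) => //.
- near=> n.
  have n1 : 1 < n%:R :> R by rewrite ltr1n; near: n; exact: nbhs_infty_gt.
  have a100 : 100 <= ln (log2 n%:R) :> R by near: n; exact: near_ge_ln_log2.
  have [r0 ra] := ratio n a100 n1; rewrite rhoE //.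
  have := ler_wpM2l r0 a100; lra.
- near=> n; have [||] // := lnB n.
  + by near: n; exact: near_ge_ln_log2.
  + by rewrite ltr1n; near: n; exact: nbhs_infty_gt.
- near=> n.
  have n1 : 1 < n%:R :> R by rewrite ltr1n; near: n; exact: nbhs_infty_gt.
  have a100 : 100 <= ln (log2 n%:R) :> R by near: n; exact: near_ge_ln_log2.
  have [_ ->] := lnB n a100 n1; rewrite (ln_ln erefl n1).
  have /andP[q1 q0] := ln_ln2_itv R.
  have l2' : ln 2 <= 2 :> R by rewrite ltW ?ln_sublinear.
  have la : ln (ln (log2 n%:R)) <= ln (log2 n%:R) / 4 + 4 :> R.
    by apply: ln_le_affine => //; lra.
  lra.
- move=> C C1; near=> n.
  have n1 : 1 < n%:R :> R by rewrite ltr1n; near: n; exact: nbhs_infty_gt.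
  have a100 : 100 <= ln (log2 n%:R) :> R by near: n; exact: near_ge_ln_log2.
  (* After this cancellation [- a / 2] remains; 18 pays for [18 * r * a] with [r * a <= 1], and
     [6 * ln C] covers [(1 + 9 / 2 * r) * ln C]. *)
  have aC : 2 * (C + 6 * ln C + 18) <= ln (log2 n%:R) by near: n; exact: near_ge_ln_log2.
  have [r0 ra] := ratio n a100 n1.
  have b0 : 0 < ln n%:R :> R by rewrite ln_gt0.
  have [_ ->] := lnB n a100 n1; rewrite (ln_ln erefl n1) rhoE //.
  have /andP[q1 q0] := ln_ln2_itv R.
  have lC : 0 <= ln C by rewrite ln_ge0.
  have p0 : 0 <= ln (ln (log2 n%:R)) :> R by rewrite ln_ge0 //; lra.
  have rb : ln (log2 n%:R) / ln n%:R * ln n%:R = ln (log2 n%:R) :> R.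
    by rewrite divfK ?lt0r_neq0.
  move: r0 ra rb aC a100 b0 p0; set r := _ / _; set b := ln n%:R.
  set a := ln (log2 n%:R); set p := ln a; set q := ln (ln 2) in q1 q0 *.
  move=> r0 ra rb aC a100 b0 p0.
  have r1 : r * ln C <= 1 * ln C.
    by rewrite ler_wpM2r //; have := ler_wpM2l r0 a100; lra.
  have h : (2 + 9 * r) / 2 * (ln C + 2 * (a + q) + 2 * (b + a - (ln 2 + (p - q))) - 3 * b)
      <= (2 + 9 * r) / 2 * (ln C + 4 * a - b).
    by rewrite ler_wpM2l //; lra.
  have e : (2 + 9 * r) / 2 * (ln C + 4 * a - b)
      = ln C + 4 * a - b + 9 / 2 * (r * ln C) + 18 * (r * a) - 9 / 2 * (r * b).
    by field.
  lra.
Unshelve. all: by end_near.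
Qed.

Theorem theorem3p1 (R : realType) :
  [/\ forall rho : R, 2 < rho ->
        random_regular_aas (fun _ : nat => rho) (fun (n : nat) (G : sgraph 'I_n) =>
          n%:R `^ (3 / 2 - 1 / rho) / (4 * log2 n%:R * log2 (log2 n%:R))
            <= (min_ordered_ramsey G)%:R),
      random_regular_aas (fun _ : nat => 3 : R) (fun (n : nat) (G : sgraph 'I_n) =>
          n%:R `^ (7 / 6) / (4 * log2 n%:R * log2 (log2 n%:R))
            <= (min_ordered_ramsey G)%:R :> R)
    & random_regular_aas
        (fun n : nat => 2 + 9 * log2 (log2 n%:R) / log2 n%:R : R)
        (fun (n : nat) (G : sgraph 'I_n) =>
          n%:R * log2 n%:R / (2 * log2 (log2 n%:R))
            <= (min_ordered_ramsey G)%:R :> R)].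
Proof.
split; [exact: aas_fixed_degree| |exact: aas_near_two].
have -> : 7 / 6 = 3 / 2 - 1 / 3 :> R by field.
by apply: aas_fixed_degree; lra.
Qed.
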